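(* Let $F$ be a finitely generated non-abelian free group with finite basis $A$, let $\varphi$ be an automorphism of $F$, and let $u,v\in F(A)$ be such that neither is a prefix of the other. Then $$\varphi\big(C^2_{[u,v]}\big)=\bigcup_{u_i\in\varphi^*_A(u),\ v_j\in\varphi^*_A(v)} C^2_{[u_i,v_j]},$$ and this union is disjoint (over distinct pairs $(u_i,v_j)$).
   Context: $F(A)$ denotes the set of finite reduced words in $A\cup A^{-1}$, identified with $F$. The Gromov boundary $\partial F$ is identified with the set of infinite reduced words in $A\cup A^{-1}$. Every automorphism $\varphi$ of $F$ induces canonically a homeomorphism of $\partial F$, also denoted $\varphi$. The double boundary is $\partial^2F=(\partial F\times\partial F)\smallsetminus\{\text{diagonal}\}$, and $\varphi(X,Y)=(\varphi(X),\varphi(Y))$. For $u\in F(A)$ the cylinder $C^1_u\subset\partial F$ is the set of all infinite reduced words having $u$ as prefix; for $U\subset F(A)$, $C^1_U=\bigcup_{u\in U}C^1_u$. For every $u\in F(A)$ the image $\varphi(C^1_u)$ equals $C^1_U$ for some finite $U\subset F(A)$, and among all finite sets $U\subset F(A)$ with $C^1_U=\varphi(C^1_u)$ there is a unique one of minimal cardinality; this unique minimal set is denoted $\varphi^*_A(u)$. Let $\Gamma$ be the Cayley graph (a tree) of $F$ with respect to $A$; its vertices are identified with the elements of $F$ and its ends with $\partial F$. For distinct $X,Y\in\partial F$, $\gamma(X,Y)$ is the biinfinite reduced path in $\Gamma$ from the end $X$ to the end $Y$. For $u\neq v$ in $F(A)$ the double cylinder is $$C^2_{[u,v]}=\{(X,Y)\in\partial^2F\mid\gamma(X,Y)\text{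 passes through }u\text{ and }v\text{ (in that order)}\}.$$ *)

(* Defs.v *)
From HB Require Import structures.
From mathcomp Require Import all_boot all_order all_algebra finmap.
From mathcomp Require Import boolp classical_sets functions.

Set Implicit Arguments.
Unset Strict Implicit.
Unset Printing Implicit Defensive.

Local Open Scope group_scope.
Local Open Scope classical_set_scope.

(* The pair (a, false) stands for the letter a and (a, true) for a^-1. *)
Definition letter (A : finType) := (A * bool)%type.

Definition linv (A : finType) (a : letter A) : letter A := (a.1, ~~ a.2).

Definition reduced (A : finType) (w : seq (letter A)) : bool :=
  sorted (fun a b => b != linv a) w.

Record freegroup (A : finType) := FreeGroup {
  word :> seq (letter A);
  word_reduced : reduced word
}.

HB.instance Definition _ (A : finType) := [isSub for @word A].
HB.instance Definition _ (A : finType) := [Choice of freegroup A by <:].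

Section FreeGroup.
Variable A : finType.
Implicit Types (a b : letter A) (w x y : seq (letter A)) (u v : freegroup A).

Lemma linvK : involutive (@linv A).
Proof. by move=> [a s]; rewrite /linv /= negbK. Qed.

(* The reduced form of a :: w, for w reduced. *)
Definition push a w : seq (letter A) :=
  if w is b :: w' then if b == linv a then w' else a :: w else [:: a].

Lemma push_reduced a w : reduced w -> reduced (push a w).
Proof.
case: w => [|b w] //= red_w; case: eqP => [_|/eqP neq_ba].
  exact: path_sorted red_w.
by rewrite /= neq_ba.
Qed.

Lemma push_linvK a w : reduced w -> push a (push (linv a) w) = w.
Proof.
case: w => [|b w] /=; first by rewrite eqxx.
case: eqP => [->|_] red_w; last by rewrite /= eqxx.
by rewrite linvK in red_w *; case: w red_w => [|c w] //= /andP[/negPf->].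
Qed.

Definition mulw x y := foldr push y x.

Lemma mulw_reduced x y : reduced y -> reduced (mulw x y).
Proof. by move=> red_y; elim: x => //= a x; apply: push_reduced. Qed.

Lemma mulw_push a x y :
  reduced x -> reduced y -> mulw (push a x) y = push a (mulw x y).
Proof.
case: x => [|b x] //= red_x red_y; case: eqP => [->|_] //.
by rewrite push_linvK //; apply: mulw_reduced.
Qed.

Lemma mulw_nil x : reduced x -> mulw x [::] = x.
Proof.
elim: x => //= a x IHx red_x; rewrite IHx; last exact: path_sorted red_x.
by case: x red_x {IHx} => [|b x] //= /andP[/negPf->].
Qed.

Definition invw x := rev (map (@linv A) x).

Lemma invw_reduced x : reduced x -> reduced (invw x).
Proof.
rewrite /reduced /invw rev_sorted sorted_map; apply: sub_sorted => a b /=.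
by rewrite linvK eq_sym.
Qed.

Lemma mul_invw x : mulw (invw x) x = [::].
Proof.
elim: x => //= a x IHx; rewrite /invw /= rev_cons /mulw foldr_rcons /=.
by rewrite linvK eqxx.
Qed.

Definition fg_one : freegroup A := @FreeGroup A [::] isT.
Definition fg_mul u v : freegroup A :=
  FreeGroup (mulw_reduced u (word_reduced v)).
Definition fg_inv u : freegroup A := FreeGroup (invw_reduced (word_reduced u)).

Lemma fg_mulA : associative fg_mul.
Proof.
move=> u v w; apply: val_inj; case: u => u /= _; elim: u => //= a u IHu.
by rewrite IHu mulw_push ?mulw_reduced ?word_reduced.
Qed.

Lemma fg_mul1g : left_id fg_one fg_mul.
Proof. by move=> u; apply: val_inj. Qed.

Lemma fg_mulg1 : right_id fg_one fg_mul.
Proof. by move=> u; apply: val_inj; rewrite /= mulw_nil ?word_reduced. Qed.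

Lemma fg_mulVg : left_inverse fg_one fg_inv fg_mul.
Proof. by move=> u; apply: val_inj; rewrite /= mul_invw. Qed.

Lemma fg_invK : involutive fg_inv.
Proof.
move=> u; apply: val_inj; rewrite /= /invw map_rev revK -map_comp.
by rewrite map_id_in // => a _; rewrite /= linvK.
Qed.

Lemma fg_mulgV : right_inverse fg_one fg_inv fg_mul.
Proof. by move=> u; rewrite -{1}[u]fg_invK fg_mulVg. Qed.

HB.instance Definition _ := isGroup.Build (freegroup A)
  fg_mulA fg_mul1g fg_mulg1 fg_mulVg fg_mulgV.

Definition gen a : freegroup A := @FreeGroup A [:: a] isT.

Record boundary := Boundary {
  ray :> nat -> letter A;
  ray_reduced : forall n, ray n.+1 != linv (ray n)
}.

HB.instance Definition _ := gen_eqMixin boundary.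
HB.instance Definition _ := gen_choiceMixin boundary.

Lemma mkseq_ray_reduced (X : boundary) n : reduced (mkseq X n).
Proof.
apply/(sortedP (X 0)) => i; rewrite size_mkseq => lt_in.
by rewrite !nth_mkseq ?(ltnW lt_in) ?ray_reduced.
Qed.

Definition ray_prefix (X : boundary) n : freegroup A :=
  FreeGroup (mkseq_ray_reduced X n).

(* Convergence in the compactification of F by its boundary: each prefix of X
   is a prefix of all but finitely many of the words s n. *)
Definition converges (s : nat -> freegroup A) (X : boundary) : Prop :=
  forall k, exists N, forall n, (N <= n)%N -> prefix (ray_prefix X k) (s n).

(* The continuous extension of phi to the boundary.  The limit always exists
   when phi is an automorphism; the default value X is then irrelevant. *)
Definition boundary_map (phi : freegroup A -> freegroup A) (X : boundary) :
    boundary :=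
  xget X [set Y | converges (fun n => phi (ray_prefix X n)) Y].

Definition boundary_map2 (phi : freegroup A -> freegroup A)
    (P : boundary * boundary) : boundary * boundary :=
  (boundary_map phi P.1, boundary_map phi P.2).

Definition cyl1 u : set boundary := [set X | ray_prefix X (size u) = u].

Definition cyl1s (U : {fset freegroup A}) : set boundary :=
  \bigcup_(u in [set` U]) cyl1 u.

Definition is_min_image_cover (phi : freegroup A -> freegroup A) u
    (U : {fset freegroup A}) : Prop :=
  cyl1s U = boundary_map phi @` cyl1 u /\
  forall V : {fset freegroup A},
    cyl1s V = boundary_map phi @` cyl1 u -> (#|` U| <= #|` V|)%N.

(* phi^*_A(u); the default value is irrelevant: for an automorphism phi and
   #|A| >= 2, exactly one finite set satisfies the predicate. *)
Definition phistar (phi : freegroup A -> freegroup A) u : {fset freegroup A} :=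
  xget fset0 [set U | is_min_image_cover phi u U].

Definition cayley_adj : rel (freegroup A) :=
  fun g h => [exists a : letter A, h == g * gen a].

(* p is a parametrization of the biinfinite reduced path gamma(X, Y), which is
   unique up to a shift of the parameter. *)
Definition is_biinf_path (X Y : boundary) (p : int -> freegroup A) : Prop :=
  [/\ forall i : int, cayley_adj (p i) (p (i + 1)%R),
      forall i : int, p i <> p (i + 2)%R,
      converges (fun n : nat => p (- n%:Z)%R) X
    & converges (fun n : nat => p n%:Z%R) Y].

Definition passes_through (X Y : boundary) u v : Prop :=
  exists p : int -> freegroup A, is_biinf_path X Y p /\
    exists i j : int, [/\ (i <= j)%R, p i = u & p j = v].

Definition double_boundary : set (boundary * boundary) :=
  [set P | P.1 <> P.2].

Definition cyl2 u v : set (boundary * boundary) :=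
  [set P | double_boundary P /\ passes_through P.1 P.2 u v].

End FreeGroup.

(* Main.v *)
Require Import Defs.
From HB Require Import structures.
From mathcomp Require Import all_boot all_order all_algebra finmap.
From mathcomp Require Import boolp classical_sets functions.
From mathcomp Require Import zify.

(* Neither of u and v being a prefix of the other, C^2_[u,v] is the product
   C^1_u x C^1_v: a reduced path of the tree cannot turn back once it moves away
   from the root, so a path through u and then v ends beyond v and, read
   backwards, beyond u.  The cylinders in a minimal cover are nonempty and
   pairwise disjoint, otherwise one of them could be dropped.  As phi(C^1_u) and
   phi(C^1_v) are disjoint, no u_i is comparable with any v_j, and the double
   cylinders on the right are products as well.
   The boundary map is defined and invertible because long words with a long
   common prefix have images with a long common prefix; the same uniformity for
   the inverse automorphism shows that phi(C^1_u) is a finite union of cylinders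
   over words of one fixed length. *)

Set Implicit Arguments.
Unset Strict Implicit.

Local Open Scope classical_set_scope.

(** * Prefixes of a common word *)

Lemma prefix_comparable {T : eqType} (s1 s2 s : seq T) :
  prefix s1 s -> prefix s2 s -> size s1 <= size s2 -> prefix s1 s2.
Proof.
rewrite !prefixE => /eqP e1 /eqP e2 le12.
by rewrite -e2 take_takel // e1.
Qed.

Lemma prefix_total {T : eqType} (s1 s2 s : seq T) :
  prefix s1 s -> prefix s2 s -> prefix s1 s2 || prefix s2 s1.
Proof.
move=> p1 p2; case/orP: (leq_total (size s1) (size s2)) => [le12|le21].
  by rewrite (prefix_comparable p1 p2).
by rewrite orbC (prefix_comparable p2 p1).
Qed.

Lemma prefix_size_eq {T : eqType} (s1 s2 : seq T) :
  prefix s1 s2 -> size s1 = size s2 -> s1 = s2.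
Proof. by rewrite prefixE => /eqP + e; rewrite e take_size. Qed.

Section FreeGroup.
Variable A : finType.
Implicit Types (a b : letter A) (u v w x y p q : freegroup A).
Implicit Types (X Y : boundary A).

(** * Cancellation and length in products of reduced words *)

Lemma mulw_cat (s t : seq (letter A)) : reduced (s ++ t) -> mulw s t = s ++ t.
Proof.
elim: s => //= a s IHs red_st; rewrite IHs; last exact: path_sorted red_st.
by case: (s ++ t) red_st => [|b r] //= /andP[/negPf->].
Qed.

Lemma word_inj : injective (@word A).
Proof. exact: val_inj. Qed.

Variant mulg_gen_spec x a : freegroup A -> Prop :=
  | MulgGenUp y of word y = rcons x a : mulg_gen_spec x a y
  | MulgGenDown y of word x = rcons y (linv a) : mulg_gen_spec x a y.

(** Right multiplication by a letter is a step along an edge of the tree: away from the root if the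
    letter does not cancel, towards it if it cancels the last letter of [x]. *)
Lemma mulg_genP x a : mulg_gen_spec x a (x * gen a)%g.
Proof.
have up (z : freegroup A) b :
      reduced (rcons z b) -> word (z * gen b)%g = rcons z b.
  by move=> red; rewrite /= mulw_cat cats1.
have [/up|] := boolP (reduced (rcons x a)); first exact: MulgGenUp.
move=> nred; apply: MulgGenDown; move: nred.
have [t ex] : exists t, word x = t by exists (word x).
rewrite ex; case/lastP: t ex => [|s b] ex //.
have red_sb : reduced (rcons s b) by rewrite -ex word_reduced.
have red_s : reduced s := prefix_sorted (prefix_rcons s b) red_sb.
(* As [rcons s b] is reduced, only the junction between [b] and [a] can fail to be reduced. *)
move=> nred; have eb : b = linv a.
  apply: contraNeq nred => neb; rewrite /reduced.
  case: s red_sb {ex red_s} => [_|c s] /=.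
    by rewrite andbT; apply: contra neb => /eqP->; rewrite linvK.
  rewrite !rcons_path last_rcons => -> /=.
  by apply: contra neb => /eqP->; rewrite linvK.
have def_x : x = (FreeGroup red_s * gen b)%g by apply: word_inj; rewrite up.
rewrite def_x eb -mulgA (_ : (gen _ * gen a)%g = 1%g) ?mulg1 //.
by apply: word_inj; rewrite /= linvK eqxx.
Qed.

(** Letters are appended on the right, and the side condition records that the new letter does not
    cancel. *)
Lemma freegroup_ind (P : freegroup A -> Prop) :
  P 1%g ->
  (forall x a, word (x * gen a)%g = rcons x a -> P x -> P (x * gen a)%g) ->
  forall x, P x.
Proof.
move=> P1 PM [s]; elim/last_ind: s => [|s a IHs] red_sa.
  by rewrite (_ : FreeGroup red_sa = 1%g) //; apply: val_inj.
have red_s : reduced s := prefix_sorted (prefix_rcons s a) red_sa.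
have ew : word (FreeGroup red_s * gen a)%g = rcons s a.
  by rewrite /= mulw_cat cats1.
have -> : FreeGroup red_sa = (FreeGroup red_s * gen a)%g by apply: val_inj.
exact: PM.
Qed.

Lemma size_mulg x y : size (x * y)%g <= size x + size y.
Proof.
elim/freegroup_ind: y => [|y a ey IHy]; first by rewrite mulg1 leq_addr.
rewrite ey size_rcons mulgA addnS; case: mulg_genP => z ez.
  by rewrite ez size_rcons.
by rewrite ez size_rcons in IHy; lia.
Qed.

(** Each letter of [y] removes at most one letter from the end, so the first [k] letters of [x] are
    out of reach. The induction carries the bound on the length of the product along. *)
Lemma take_mulg x y k :
  k + size y <= size x -> k <= size (x * y)%g /\ take k (x * y)%g = take k x.
Proof.
suff: k + size y <= size x ->
    size x <= size (x * y)%g + size y /\ take k (x * y)%g = take k x.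
  by move=> + le => /(_ le)[? ?]; split=> //; lia.
elim/freegroup_ind: y => [_|y a ey IHy]; first by rewrite mulg1 leq_addr.
rewrite ey size_rcons mulgA => le_kx.
have [|] := IHy; first by lia.
move: (x * y)%g {IHy} => xy le_x <-.
case: mulg_genP => z ez.
  by rewrite ez size_rcons -cats1 takel_cat; [split=> //; lia | lia].
rewrite ez size_rcons in le_x *.
by rewrite -cats1 takel_cat; [split=> //; lia | lia].
Qed.

(** * Endomorphisms are Lipschitz for the word length *)

Section Morphism.
Variable f : freegroup A -> freegroup A.
Hypothesis fM : {morph f : x y / (x * y)%g}.

Definition max_gen_size : nat := \max_a size (f (gen a)).

Lemma size_morph x : size (f x) <= max_gen_size * size x.
Proof.
elim/freegroup_ind: x => [|x a ex IHx].
  by rewrite (_ : f 1%g = 1%g) //; apply: (mulgI (f 1%g)); rewrite -fM !mulg1.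
rewrite fM ex size_rcons mulnS addnC.
apply: leq_trans (size_mulg _ _) _; apply: leq_add => //.
exact: (leq_bigmax a).
Qed.

End Morphism.

(** * Extension of an automorphism to the boundary *)

Section Automorphism.
Variables f g : freegroup A -> freegroup A.
Hypotheses (fM : {morph f : x y / (x * y)%g})
  (gM : {morph g : x y / (x * y)%g}).
Hypothesis fK : cancel f g.

Lemma ray_prefix_prefix X m n :
  m <= n -> prefix (ray_prefix X m) (ray_prefix X n).
Proof.
move=> le_mn; rewrite prefixE /= size_mkseq /mkseq -map_take take_iota.
by rewrite (minn_idPl le_mn).
Qed.

Lemma size_ray_prefix X n : size (ray_prefix X n) = n.
Proof. exact: size_mkseq. Qed.

Lemma boundary_eqP X Y : (forall n, ray_prefix X n = ray_prefix Y n) -> X = Y.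
Proof.
move=> eqXY; have: ray X = ray Y.
  apply: funext => n.
  have /(congr1 (nth (X 0) ^~ n)) := congr1 (@word A) (eqXY n.+1).
  by rewrite /= !nth_mkseq.
case: X Y {eqXY} => [X pX] [Y pY] /= eXY; rewrite eXY in pX *.
by congr Boundary; apply: Prop_irrelevance.
Qed.

Lemma cyl1P u X n : size u <= n -> cyl1 u X <-> prefix u (ray_prefix X n).
Proof.
move=> le_un; split=> [<-|u_X].
  by rewrite ray_prefix_prefix ?size_ray_prefix.
apply/word_inj/prefix_size_eq; last by rewrite size_ray_prefix.
apply: (@prefix_comparable _ _ _ (ray_prefix X n)); rewrite ?size_ray_prefix //.
exact: ray_prefix_prefix.
Qed.

Lemma cyl1_prefix_total u v X :
  cyl1 u X -> cyl1 v X -> prefix u v || prefix v u.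
Proof.
move=> /(cyl1P X (leq_addr (size v) (size u))) pu.
move=> /(cyl1P X (leq_addl (size u) (size v))); exact: prefix_total.
Qed.

Lemma sub_cyl1 u v X : prefix u v -> cyl1 v X -> cyl1 u X.
Proof.
move=> uv vX; apply/(cyl1P X (size_prefix uv)); apply: prefix_trans uv _.
exact/(cyl1P X (leqnn _)).
Qed.

Lemma cauchy_converges (a0 : letter A) (s : nat -> freegroup A) :
  (forall k, exists N, forall n, N <= n ->
     k <= size (s n) /\ take k (s n) = take k (s N)) ->
  exists X, converges s X.
Proof.
(* The letter of index [i] is read where the prefix of length [i.+1] is already stable; [a0] is only
   a default for [nth]. *)
move=> /choice[N] /= sN; pose y i := nth a0 (s (N i.+1)) i.
have s_take k n : N k <= n -> take k (s n) = mkseq y k.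
  move=> le_n; have [le_k _] := sN k n le_n; apply: (@eq_from_nth _ a0).
    by rewrite size_mkseq size_takel.
  move=> i; rewrite size_takel // => lt_ik; rewrite nth_take // nth_mkseq //.
  have eq_m : take k (s n) = take k (s (maxn n (N i.+1))).
    have le_m := leq_trans le_n (leq_maxl n (N i.+1)).
    by rewrite (sN k n le_n).2 (sN k _ le_m).2.
  rewrite -[LHS](nth_take _ lt_ik) eq_m nth_take //.
  by rewrite -(nth_take _ (ltnSn i)) (sN i.+1 _ (leq_maxr _ _)).2 nth_take.
have y_red n : y n.+1 != linv (y n).
  have : reduced (mkseq y n.+2).
    rewrite -(s_take _ _ (leqnn _)).
    exact: prefix_sorted (prefix_take _ _) (word_reduced _).
  by move=> /(sortedP a0) /(_ n); rewrite size_mkseq !nth_mkseq //; apply.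
exists (Boundary y_red) => k; exists (N k) => n /s_take yk.
by rewrite /= -yk prefix_take.
Qed.

Lemma converges_cyl1 s X u :
  converges s X -> (exists N, forall n, N <= n -> prefix u (s n)) -> cyl1 u X.
Proof.
move=> /(_ (size u))[M sX] [N su]; apply/(cyl1P X (leqnn _)).
apply: prefix_comparable (su _ (leq_maxr M N)) (sX _ (leq_maxl M N)) _.
by rewrite size_ray_prefix.
Qed.

(* As [f] has a Lipschitz inverse, [f x] is long when [x] is, so multiplying
   [x] by one more letter cannot alter the first [k] letters of [f x]. *)
Lemma morph_prefix_stable k : exists N, forall p x,
  N <= size p -> prefix p x -> k <= size (f p) /\ take k (f x) = take k (f p).
Proof.
(* The Lipschitz bound for [g] gives [size p <= max_gen_size g * size (f p)]; this threshold
   therefore keeps [f p] longer than [k] by at least the image of one letter. *)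
exists (max_gen_size g * (k + max_gen_size f)).+1 => p x le_p.
have large y : prefix p y -> k + max_gen_size f <= size (f y).
  move=> /size_prefix le_py; have := size_morph gM (f y); rewrite fK => le_y.
  rewrite leqNgt; apply/negP => /ltnW /(leq_mul (leqnn (max_gen_size g))).
  by apply/negP; rewrite -ltnNge (leq_trans le_p) // (leq_trans le_py).
move=> p_x; split; first by have := large p (prefix_refl _); lia.
elim/freegroup_ind: x p_x => [|x a ex IHx p_x].
  by rewrite prefixs0 => /eqP ep; rewrite ep in le_p.
have := size_prefix p_x; rewrite {1}ex size_rcons leq_eqVlt.
move=> /orP[/eqP e|le_px].
  have -> // : p = (x * gen a)%g.
  by apply/word_inj/prefix_size_eq => //; rewrite e ex size_rcons.
have p_x' : prefix p x 
  by apply: prefix_comparable p_x _ le_px; rewrite ex prefix_rcons.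
rewrite -(IHx p_x') fM.
apply: (take_mulg _).2; apply: leq_trans (large x p_x'); rewrite leq_add2l.
exact: (leq_bigmax a).
Qed.

(** The limit exists, so the default value in [boundary_map] is never taken. *)
Lemma boundary_map_converges X :
  converges (fun n => f (ray_prefix X n)) (boundary_map f X).
Proof.
apply: (xgetPex X); apply: (cauchy_converges (X 0)) => k.
have [N fN] := morph_prefix_stable k; exists N => n le_n.
have le_size m : N <= m -> N <= size (ray_prefix X m).
  by rewrite size_ray_prefix.
have [_ ->] := fN _ _ (le_size _ (leqnn N)) (ray_prefix_prefix X le_n).
by have [-> _] := fN _ _ (le_size _ le_n) (prefix_refl _).
Qed.

(** Uniform continuity of the boundary map: [N] depends on [k] but not on [X]. *)
Lemma boundary_map_prefix k : exists N, forall X n x, N <= n ->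
  prefix (ray_prefix X n) x -> prefix (ray_prefix (boundary_map f X) k) (f x).
Proof.
have [N fN] := morph_prefix_stable k; exists N => X n x le_n X_x.
have [M cvg] := boundary_map_converges X k.
have le_size : N <= size (ray_prefix X n) by rewrite size_ray_prefix.
have [_ eqx] := fN _ _ le_size X_x.
have [_ eqm] := fN _ _ le_size (ray_prefix_prefix X (leq_maxr M n)).
by have := cvg _ (leq_maxl M n); rewrite !prefixE size_ray_prefix eqm eqx.
Qed.

End Automorphism.

Lemma boundary_mapK (f g : freegroup A -> freegroup A) :
  {morph f : x y / (x * y)%g} -> {morph g : x y / (x * y)%g} ->
  cancel f g -> cancel g f -> cancel (boundary_map f) (boundary_map g).
Proof.
move=> fM gM fK gK X; apply: boundary_eqP => k.
have [M gP] := boundary_map_prefix gM fM gK k.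
have [N fP] := boundary_map_prefix fM gM fK M.
(* Taking [maxn N k] letters of [X] is enough both for continuity and for reading off [k] letters
   after [fK]. *)
have := gP _ _ _ (leqnn M) (fP X _ _ (leq_maxl N k) (prefix_refl _)).
rewrite fK => /cyl1P; rewrite /cyl1 /= size_mkseq leq_maxr.
by move=> /(_ isT).
Qed.

(** * Images of cylinders as finite unions of cylinders *)

Section ImageCylinder.
Variables f g : freegroup A -> freegroup A.
Hypotheses (fM : {morph f : x y / (x * y)%g})
  (gM : {morph g : x y / (x * y)%g}).
Hypotheses (fK : cancel f g) (gK : cancel g f).

Lemma image_cyl1E u :
  boundary_map f @` cyl1 u = [set Y | cyl1 u (boundary_map g Y)].
Proof.
have KfM := boundary_mapK fM gM fK gK; have KgM := boundary_mapK gM fM gK fK.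
apply/seteqP; split=> [_ [X uX <-]|Y uY] /=; first by rewrite KfM.
by exists (boundary_map g Y).
Qed.

(** By uniform continuity of the inverse, the first [M] letters of [Y] decide whether the preimage
    of [Y] begins with [u], and there are finitely many words of length [M]. *)
Lemma image_cyl1_cover u : exists U, cyl1s U = boundary_map f @` cyl1 u.
Proof.
have [M gP] := boundary_map_prefix gM fM gK (size u).
(* Tuples that are not reduced become [1], which is harmless since [U] tests each element again. *)
pose words_M :=
  [seq insubd (1%g : freegroup A) (val t) | t : M.-tuple (letter A)].
pose U := [fset x in words_M | (size x == M) && prefix u (g x)]%fset.
exists U; rewrite image_cyl1E; apply/seteqP.
have gY Y : prefix u (g (ray_prefix Y M)) <-> cyl1 u (boundary_map g Y).
  have {}gP := gP Y M _ (leqnn M) (prefix_refl _).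
  split=> [pu|<- //].
  apply/word_inj/esym/prefix_size_eq; rewrite ?size_ray_prefix //.
  by apply: prefix_comparable gP _; rewrite ?size_ray_prefix.
split=> Y /=.
  move=> [w /=]; rewrite !inE => /andP[_ /andP[/eqP sw uw]].
  by rewrite /cyl1 /= sw => ew; apply/gY; rewrite ew.
move=> /gY uY; exists (ray_prefix Y M); last by rewrite /cyl1 /= size_mkseq.
rewrite /= !inE size_ray_prefix eqxx uY !andbT.
apply/mapP; exists (Tuple (introT eqP (size_mkseq Y M))); first exact: mem_enum.
by apply: word_inj; rewrite -[RHS]/(val _) insubdK //; apply: mkseq_ray_reduced.
Qed.

Lemma phistar_min u : is_min_image_cover f u (phistar f u).
Proof.
apply: xgetPex.
pose P n := `[< exists2 U, cyl1s U = boundary_map f @` cyl1 u & #|` U| = n >].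
have exP : exists n, P n.
  by have [U UE] := image_cyl1_cover u; exists #|` U|; apply/asboolP; exists U.
have [n /asboolP[U UE <-] minU] := ex_minnP exP.
by exists U; split=> // V VE; apply: minU; apply/asboolP; exists V.
Qed.

End ImageCylinder.

(** * Minimal covers by cylinders *)

Section MinimalCover.
Variables (f : freegroup A -> freegroup A) (u : freegroup A).
Variable U : {fset freegroup A}.
Hypothesis minU : is_min_image_cover f u U.

Lemma min_cover_irredundant w : w \in U -> ~ (cyl1 w `<=` cyl1s (U `\ w)%fset).
Proof.
case: minU => UE leU wU sub.
suff /leU : cyl1s (U `\ w)%fset = boundary_map f @` cyl1 u.
  by rewrite [X in (X <= _)%N](cardfsD1 w) wU ltnn.
rewrite -UE; apply/seteqP; split=> X [z /= zU zX].
  by exists z => //=; move: zU; rewrite !inE => /andP[].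
have [ezw|nzw] := eqVneq z w; first by apply: sub; rewrite -ezw.
by exists z; rewrite //= !inE nzw.
Qed.

Lemma min_cover_nonempty w : w \in U -> exists X, cyl1 w X.
Proof.
move=> wU; apply: contrapT => noX; apply: (min_cover_irredundant wU) => X wX.
by case: noX; exists X.
Qed.

(** Two cylinders that meet are nested, and in a minimal cover the inner one would be redundant. *)
Lemma min_cover_disjoint w z X :
  w \in U -> z \in U -> cyl1 w X -> cyl1 z X -> w = z.
Proof.
have wlog_prefix w' z' : w' \in U -> z' \in U -> prefix w' z' -> w' = z'.
  move=> wU zU pwz; apply: contrapT => nwz.
  apply: (min_cover_irredundant zU) => Y zY.
  exists w'; last exact: sub_cyl1 pwz zY.
  by rewrite /= !inE wU andbT; apply/eqP.
move=> wU zU wX zX; have /orP[pwz|pzw] := cyl1_prefix_total wX zX.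
  exact: wlog_prefix.
exact/esym/wlog_prefix.
Qed.

End MinimalCover.

(** * Reduced paths in the Cayley tree *)

Section ReducedPath.
Variable q : nat -> freegroup A.
Hypotheses (q_adj : forall n, cayley_adj (q n) (q n.+1))
  (q_red : forall n, q n <> q n.+2).

Lemma path_step n :
  (size (q n.+1) = (size (q n)).+1 /\ prefix (q n) (q n.+1)) \/
  (size (q n) = (size (q n.+1)).+1 /\ prefix (q n.+1) (q n)).
Proof.
have /existsP[a /eqP ->] := q_adj n; case: mulg_genP => y ey; rewrite ey.
  by left; rewrite size_rcons prefix_rcons.
by right; rewrite size_rcons prefix_rcons.
Qed.

(* A reduced path in the tree that moves away from the root can never turn back:
   the only neighbour of a vertex closer to the root is the one it came from. *)
Lemma path_up_step n : prefix (q n) (q n.+1) -> prefix (q n.+1) (q n.+2).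
Proof.
move=> up; case: (path_step n.+1) => [[]//|[e2 down]]; case: (@q_red n).
case: (path_step n) => [[e1 _]|[e1 _]].
  2: by have := size_prefix up; rewrite e1 ltnn.
have e : size (q n) = size (q n.+2) by move: e2; rewrite e1 => -[].
by apply/word_inj/prefix_size_eq => //; apply: prefix_comparable up down _;
  rewrite e.
Qed.

Lemma path_up n m : prefix (q n) (q n.+1) -> prefix (q n) (q (n + m)).
Proof.
(* The induction also needs that the path is still moving away from the root at time [n + m]. *)
move=> up; suff: prefix (q n) (q (n + m)) && prefix (q (n + m)) (q (n + m).+1).
  by case/andP.
elim: m => [|m /andP[IH1 IH2]]; first by rewrite addn0 prefix_refl.
by rewrite addnS path_up_step // (prefix_trans IH1 IH2).
Qed.

(** An upward step would persist, so a downward step at time [n] forces all earlier steps to be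
    downward. *)
Lemma path_down n l :
  ~~ prefix (q n) (q n.+1) -> l <= n.+1 -> prefix (q n.+1) (q l).
Proof.
elim: n => [|n IHn] down.
  rewrite leq_eqVlt ltnS leqn0 => /orP[]/eqP->; first exact: prefix_refl.
  by case: (path_step 0) => -[_ //]; rewrite (negPf down).
have down_n : prefix (q n.+2) (q n.+1).
  by case: (path_step n.+1) => -[_ //]; rewrite (negPf down).
rewrite leq_eqVlt => /orP[/eqP->|]; first exact: prefix_refl.
rewrite ltnS => /IHn; move=> IH; apply: prefix_trans down_n (IH _).
by apply: contra down => /path_up_step.
Qed.

(** If the step into [q m] went down, the whole path so far would descend and [q m] would be a
    prefix of [q 0]. Hence that step goes up, and so do all later ones. *)
Lemma path_stays m n : ~~ prefix (q m) (q 0) -> prefix (q m) (q (m + n)).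
Proof.
case: m => [|m] np; first by rewrite prefix_refl in np.
apply/path_up/path_up_step; apply: contraNT np => down; exact: path_down.
Qed.

End ReducedPath.

(** * Double cylinders as products of cylinders *)

Lemma cayley_adj_sym : symmetric (@cayley_adj A).
Proof.
have sub x y : cayley_adj x y -> cayley_adj y x.
  move=> /existsP[a /eqP->]; apply/existsP; exists (linv a); apply/eqP.
  rewrite -mulgA (_ : (gen a * _)%g = 1%g) ?mulg1 //.
  by apply: word_inj; rewrite /= eqxx.
by move=> x y; apply/idP/idP; apply: sub.
Qed.

Lemma cayley_adj_ray X n : cayley_adj (ray_prefix X n) (ray_prefix X n.+1).
Proof.
apply/existsP; exists (X n); apply/eqP; apply: word_inj.
have e : mkseq X n.+1 = mkseq X n ++ [:: X n] by rewrite mkseqS cats1.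
by rewrite /= mulw_cat -?e ?mkseq_ray_reduced.
Qed.

Lemma converges_ray k X : converges (fun n => ray_prefix X (k + n)) X.
Proof.
move=> m; exists m => n le_m.
by rewrite ray_prefix_prefix // (leq_trans le_m) ?leq_addl.
Qed.

Lemma passes_through_cyl1 u v X Y : ~~ prefix u v -> ~~ prefix v u ->
  passes_through X Y u v -> cyl1 u X /\ cyl1 v Y.
Proof.
move=> nuv nvu [p [[adj red cX cY] [i [j [le_ij pi pj]]]]].
have [m ej] : exists m : nat, j = (i + m%:Z)%R by exists `|j - i|%N; lia.
split.
  (* The path read backwards starts at [v] and reaches [u] at time [m]; it then stays beyond [u] on
     its way to [X]. *)
  pose q n := p (j - n%:Z)%R.
  have q_adj n : cayley_adj (q n) (q n.+1).
    rewrite cayley_adj_sym /q (_ : j - n%:Z = j - n.+1%:Z + 1)%R //; lia.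
  have q_red n : q n <> q n.+2.
    move=> /esym; rewrite /q (_ : j - n%:Z = j - n.+2%:Z + 2)%R;
      [exact: red | lia].
  have qm : q m = u by rewrite -pi /q; congr p; lia.
  have q0 : q 0 = v by rewrite -pj /q; congr p; lia.
  apply: (converges_cyl1 cX); exists `|i|%N => n le_n.
  have := path_stays q_adj q_red (m := m) `|(n%:Z + i)%R|%N.
  rewrite qm q0 => /(_ nuv).
  by rewrite /q (_ : j - (m + _)%:Z = - n%:Z)%R //; lia.
(* Forwards, the path starts at [u] and reaches [v] at time [m]. *)
pose q n := p (i + n%:Z)%R.
have q_adj n : cayley_adj (q n) (q n.+1).
  by rewrite /q (_ : i + n.+1%:Z = i + n%:Z + 1)%R //; lia.
have q_red n : q n <> q n.+2.
  by rewrite /q (_ : i + n.+2%:Z = i + n%:Z + 2)%R //; lia.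
have qm : q m = v by rewrite -pj /q; congr p; lia.
have q0 : q 0 = u by rewrite -pi /q; congr p; lia.
apply: (converges_cyl1 cY); exists `|j|%N => n le_n.
have := path_stays q_adj q_red (m := m) `|(n%:Z - j)%R|%N.
rewrite qm q0 => /(_ nvu).
by rewrite /q (_ : i + (m + _)%:Z = n%:Z)%R //; lia.
Qed.

Lemma biinf_path_exists X Y : X <> Y -> exists k (p : int -> freegroup A),
  [/\ is_biinf_path X Y p, ray_prefix X k = ray_prefix Y k,
      forall n : nat, p (- n%:Z)%R = ray_prefix X (k + n)
    & forall n : nat, p n%:Z%R = ray_prefix Y (k + n)].
Proof.
move=> nXY.
(* The least such [k] is the length of the longest common prefix of [X] and [Y]; the path [p] is at
   this branching point at time 0. *)
have exk : exists k, ray_prefix X k.+1 != ray_prefix Y k.+1.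
  apply: contrapT => noK; apply: nXY; apply: boundary_eqP => -[|k].
    exact: word_inj.
  by apply/eqP; apply: contrapT => /negP nk; apply: noK; exists k.
have [k neqk mink] := ex_minnP exk.
have eqk : ray_prefix X k = ray_prefix Y k.
  case: k mink {neqk} => [_|k mink]; first exact: word_inj.
  by apply/eqP; apply: contraT => /mink; rewrite ltnn.
pose p (i : int) :=
  match i with
  | Posz n => ray_prefix Y (k + n)
  | Negz n => ray_prefix X (k + n.+1)
  end.
have pX (n : nat) : p (- n%:Z)%R = ray_prefix X (k + n).
  by case: n => [|n]; rewrite ?oppr0 /= ?addn0 ?eqk.
exists k, p; split=> //; split.
- move=> [n|[|n]].
  + by rewrite /= addn1 addnS cayley_adj_ray.
  + by rewrite /= addn1 addn0 -eqk cayley_adj_sym cayley_adj_ray.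
  + rewrite (_ : (Negz n.+1 + 1)%R = Negz n); last by lia.
    by rewrite /= [k + n.+2]addnS cayley_adj_sym cayley_adj_ray.
- have neq_size (W Z : boundary A) m n :
      m <> n -> ray_prefix W m <> ray_prefix Z n.
    by move=> nmn e; apply: nmn;
      rewrite -(size_ray_prefix W m) e size_ray_prefix.
  move=> [n|[|[|n]]].
  + rewrite (_ : (n%:Z + 2)%R = Posz n.+2); last by lia.
    by apply: neq_size; lia.
  (* The two neighbours of the branching point have the same length, and only the choice of [k]
     separates them. *)
  + by rewrite /= addn1; apply/eqP.
  + by rewrite /=; apply: neq_size; lia.
  + rewrite (_ : (Negz n.+2 + 2)%R = Negz n); last by lia.
    by apply: neq_size; lia.
- by under [X in converges X]funext do rewrite pX; apply: converges_ray.
- exact: converges_ray.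
Qed.

Lemma cyl2_cyl1 u v : ~~ prefix u v -> ~~ prefix v u ->
  cyl2 u v = cyl1 u `*` cyl1 v.
Proof.
move=> nuv nvu; apply/seteqP; split=> -[X Y] /=.
  by move=> [_ /=]; apply: passes_through_cyl1.
move=> [/= uX vY].
have incomparable Z : cyl1 u Z -> ~ cyl1 v Z.
  by move=> uZ /(cyl1_prefix_total uZ); rewrite (negPf nuv) (negPf nvu).
have nXY : X <> Y by move=> e; apply: (incomparable Y); rewrite // -e.
split=> //=; have [k [p [path_p eqk pX pY]]] := biinf_path_exists nXY.
(* Otherwise [u] would lie on the common prefix and [Y] would begin with both [u] and [v]. So [u]
   and [v] lie beyond the branching point, on opposite branches. *)
have lt_u : k < size u.
  rewrite ltnNge; apply/negP => le_u; apply: (incomparable Y) => //.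
  by apply/(cyl1P Y le_u); rewrite -eqk; apply/(cyl1P X le_u).
have lt_v : k < size v.
  rewrite ltnNge; apply/negP => le_v; apply: (incomparable X) => //.
  by apply/(cyl1P X le_v); rewrite eqk; apply/(cyl1P Y le_v).
exists p; split=> //; exists (- (size u - k)%:Z)%R, (size v - k)%:Z%R; split.
- lia.
- by rewrite pX subnKC ?uX // ltnW.
- by rewrite pY subnKC ?vY // ltnW.
Qed.

End FreeGroup.

Unset Implicit Arguments.

Theorem proposition1p4 (A : finType) (hA : (1 < #|A|)%N)
    (phi : {multiplicative freegroup A -> freegroup A})
    (phi_bij : bijective phi)
    (u v : freegroup A) (huv : ~~ prefix u v) (hvu : ~~ prefix v u) :
  let D := [set` phistar phi u] `*` [set` phistar phi v] in
  boundary_map2 phi @` cyl2 u v = \bigcup_(q in D) cyl2 q.1 q.2 /\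
  trivIset D (fun q => cyl2 q.1 q.2).
Proof.
have [psi phiK psiK] := phi_bij.
have phiM : {morph phi : x y / (x * y)%g} := gmulfM.
have psiM : {morph psi : x y / (x * y)%g} := can2_gmulfM phiK psiK.
have bmapK := boundary_mapK phiM psiM phiK psiK.
have minS w := phistar_min phiM psiM phiK psiK w.
have disjoint_images X : cyl1s (phistar phi u) X -> ~ cyl1s (phistar phi v) X.
  rewrite (minS u).1 (minS v).1 => -[Y uY <-] [Z vZ /(can_inj bmapK) eZY].
  have := cyl1_prefix_total uY; rewrite -eZY => /(_ _ vZ).
  by rewrite (negPf huv) (negPf hvu).
have cyl2E q : q.1 \in phistar phi u -> q.2 \in phistar phi v ->
    cyl2 q.1 q.2 = cyl1 q.1 `*` cyl1 q.2.
  (* If one word were a prefix of the other, the nonempty cylinder of the longer one would lie in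
     both images. *)
  move=> q1 q2; apply: cyl2_cyl1; apply/negP => pq.
    have [X q2X] := min_cover_nonempty (minS v) q2.
    apply: (disjoint_images X); last by exists q.2.
    by exists q.1 => //; exact: sub_cyl1 q2X.
  have [X q1X] := min_cover_nonempty (minS u) q1.
  apply: (disjoint_images X); first by exists q.1.
  by exists q.2 => //; exact: sub_cyl1 q1X.
move=> D; split.
  rewrite cyl2_cyl1 //; apply/seteqP; split=> -[X Y].
    move=> [[X' Y'] [/= uX vY] [<- <-]].
    have [w wU wX] : cyl1s (phistar phi u) (boundary_map phi X').
      by rewrite (minS u).1; exists X'.
    have [z zV zY] : cyl1s (phistar phi v) (boundary_map phi Y').
      by rewrite (minS v).1; exists Y'.
    by exists (w, z) => //; rewrite cyl2E.
  move=> [q [/= q1 q2]]; rewrite cyl2E // => -[/= q1X q2Y].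
  have : cyl1s (phistar phi u) X by exists q.1.
  have : cyl1s (phistar phi v) Y by exists q.2.
  rewrite (minS u).1 (minS v).1 => -[Y' vY' <-] [X' uX' <-].
  by exists (X', Y').
move=> [w z] [w' z'] [/= wU zV] [/= w'U z'V] [[X Y] []].
rewrite (cyl2E (w, z)) // (cyl2E (w', z')) // => -[/= wX zY] [/= w'X z'Y].
rewrite (min_cover_disjoint (minS u) wU w'U wX w'X).
by rewrite (min_cover_disjoint (minS v) zV z'V zY z'Y).
Qed.
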